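(* Let $p\ge1$ be an integer, let $\boldsymbol{\beta}=(\beta_0,\ldots,\beta_{p-1})$ be an alternate base and set $\beta=\prod_{i=0}^{p-1}\beta_i$. Suppose that for every $i\in\{0,\ldots,p-1\}$ there exist a non-zero integer $q_i$ and an ultimately periodic sequence $a_i=(a_{i,n})_{n\in\mathbb N}$ of integers such that \[\sum_{n=0}^{\infty}\frac{a_{i,n}}{\prod_{k=0}^{n}\beta_{i+k}}=\frac{1}{q_i}.\] Then $\beta$ is an algebraic integer. If moreover all these $p$ sequences have non-negative terms and for every $i\in\{0,\ldots,p-1\}$ there exists $m_i\in\mathbb N$ with $a_{i,m_ip}\ge1$, then $\beta_0,\ldots,\beta_{p-1}\in\mathbb Q(\beta)$.
   Context: An alternate base is a $p$-tuple $\boldsymbol{\beta}=(\beta_0,\ldots,\beta_{p-1})$ of real numbers $\beta_i>1$. Indices are taken modulo $p$: $\beta_n=\beta_{n\bmod p}$ for all $n\in\mathbb N$. *)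

(* Defs.v *)
From HB Require Import structures.
From mathcomp Require Import all_boot all_order all_algebra.
From mathcomp Require Import all_classical all_reals all_analysis.

Set Implicit Arguments.
Unset Strict Implicit.
Unset Printing Implicit Defensive.

Import Order.TTheory GRing.Theory Num.Theory.
Import numFieldNormedType.Exports.

Local Open Scope classical_set_scope.
Local Open Scope ring_scope.

Definition alternate_base (R : realType) (p : nat) (b : p.-tuple R) : Prop :=
  forall i : 'I_p, 1 < tnth b i.

(* For 0 < p the index n %% p is in range, so the default value 0 of the
   sequence access is never used. *)
Definition base_at (R : realType) (p : nat) (b : p.-tuple R) (n : nat) : R :=
  b`_(n %% p).

Definition base_prod (R : realType) (p : nat) (b : p.-tuple R) : R :=
  \prod_(i < p) tnth b i.

Definition ultimately_periodic (T : Type) (u : nat -> T) : Prop :=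
  exists N t : nat, (0 < t)%N /\ forall n, (N <= n)%N -> u (n + t)%N = u n.

(* The general term of the value of the digit sequence u read in the base b
   shifted by i. *)
Definition value_term (R : realType) (p : nat) (b : p.-tuple R) (i : nat)
    (u : nat -> int) : R^nat :=
  fun n => (u n)%:~R / \prod_(k < n.+1) base_at b (i + k).

Definition algebraic_integer (R : realType) (x : R) : Prop :=
  integralOver (intr : int -> R) x.

(* The field Q(x): the smallest subfield of R containing x. As 0^-1 = 0,
   divring_closed holds exactly for the subfields of R. *)
Definition rational_adjoin (R : realType) (x : R) : set R :=
  smallest (fun K : set R => divring_closed (mem K)) [set x].

(* Main.v *)
Require Import Defs.
From HB Require Import structures.
From mathcomp Require Import all_boot all_order all_algebra.
From mathcomp Require Import all_classical all_reals all_analysis.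
From mathcomp Require Import ring.

Set Implicit Arguments.
Unset Strict Implicit.
Unset Printing Implicit Defensive.

Import Order.TTheory GRing.Theory Num.Theory.
Import numFieldNormedType.Exports.

Local Open Scope classical_set_scope.
Local Open Scope ring_scope.

(* Put z = 1 / beta and x_n = 1 / (beta_0 ... beta_(n-1)), so that
   x_(n+p) = z x_n. Cutting the i-th series into blocks of length p and using
   periodicity turns the i-th hypothesis into a relation
     (1 - z^t_i) x_i = sum_(l < p) M_il(z) x_l,   M_il in Z[X],
   with M_il(0) = 0 for l <= i, since reaching such an index l from i + 1 wraps
   around the period of the base. The determinant of this system is a polynomial
   in z with integer coefficients and constant coefficient 1; as it vanishes, its
   reciprocal polynomial is monic with root beta. For non-negative digits the
   system has non-negative coefficients, positive on the cycle i -> i + 1, and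
   x is positive. A Perron-Frobenius argument (minimum principle) shows that x
   is its only solution with x_0 = 1, so x has coordinates in Q(beta) by Cramer's
   rule, and beta_i = x_i / x_(i+1). *)

(** * Reciprocal polynomials, Cramer's rule, minimum principle *)

Lemma reciprocal_root_integral (R : realType) (x : R) (P : {poly int}) :
  x != 0 -> P`_0 = 1 -> (map_poly intr P).[x^-1] = 0 -> algebraic_integer x.
Proof.
move=> x0 P0 Px.
have szP : (0 < size P)%N.
  by rewrite size_poly_gt0; apply/eqP => PE; move: P0; rewrite PE coef0.
(* Reversing the coefficients makes the constant coefficient of [P] the leading one and gives
   [Q(x) = x ^ (deg P) * P(1 / x)]. *)
pose Q : {poly int} := \poly_(i < size P) P`_((size P).-1 - i).
exists Q.
  by rewrite monicE lead_coef_poly ?subnn ?P0.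
rewrite rootE (@horner_coef_wide _ (size P)); last first.
  by rewrite (leq_trans (size_poly _ _))// size_poly.
move: Px; rewrite (@horner_coef_wide _ (size P)) ?size_poly// => Px.
rewrite (reindex_inj rev_ord_inj)/=.
apply/eqP; rewrite -[RHS](mulr0 (x ^+ (size P).-1)) -[in RHS]Px mulr_sumr.
apply: eq_bigr => i _; rewrite !coef_map_id0//= coef_poly ltn_subrL szP/=.
have lei : (i <= (size P).-1)%N by rewrite -ltnS prednK.
have -> : (size P - i.+1 = (size P).-1 - i)%N by rewrite -subn1 -subnDA add1n.
rewrite subKn// mulrCA exprVn -expfB_cond//.
by rewrite (negbTE x0).
Qed.

(** The entries of the inverse are cofactors divided by the determinant, hence rational expressions
    in the entries of [B]. *)
Lemma mulmx_invmx_divring (F : fieldType) (K : divringClosed F) n (B : 'M[F]_n)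
    (x y : 'rV[F]_n) :
  B \in unitmx -> x *m B = y -> (forall i j, B i j \in K) ->
  (forall j, y 0 j \in K) -> forall j, x 0 j \in K.
Proof.
move=> uB xB KB Ky j; rewrite -(mulmxK uB x) xB mxE rpred_sum// => k _.
have Kdet m (C : 'M[F]_m) : (forall i j, C i j \in K) -> \det C \in K.
  move=> KC; rewrite rpred_sum// => s _.
  by rewrite rpredM ?rpred_sign// rpred_prod.
rewrite rpredM// /invmx uB !mxE rpredM ?rpredV ?Kdet//.
by rewrite rpredM ?rpred_sign// Kdet// => i l; rewrite !mxE.
Qed.

(* Subtracting from w the largest multiple of x below it gives z >= 0 with a zero;
   the equations propagate zeros along the cycle up to the index 0. *)
Lemma minimum_principle (R : realFieldType) n (d x w : 'I_n.+1 -> R)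
    (M : 'I_n.+1 -> 'I_n.+1 -> R) :
  (forall i l, 0 <= M i l) -> (forall i, 0 < M i (ordS i)) ->
  (forall i, 0 < x i) -> (forall i, d i * x i = \sum_l M i l * x l) ->
  w ord0 = 0 -> (forall i, i != ord0 -> d i * w i = \sum_l M i l * w l) ->
  forall i, 0 <= w i.
Proof.
move=> M0 MS x0 Mx w0 Mw.
case: (arg_minP (fun i => w i / x i) (erefl (xpredT (@ord0 n)))) => i0 _ i0min.
pose c := w i0 / x i0; pose z i := w i - c * x i.
have z_ge0 i : 0 <= z i by rewrite subr_ge0 -ler_pdivlMr// i0min.
have Mz i : i != ord0 -> d i * z i = \sum_l M i l * z l.
  move=> i_n0; rewrite /z mulrBr Mw// mulrCA Mx mulr_sumr -sumrB.
  by apply: eq_bigr => l _; rewrite mulrBr mulrCA.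
have zS i : i != ord0 -> z i = 0 -> z (ordS i) = 0.
  move=> /Mz; move=> /[swap] ->; rewrite mulr0 => /esym/eqP.
  rewrite psumr_eq0 => [/allP/(_ (ordS i))|l _]; last exact: mulr_ge0.
  by rewrite mem_index_enum => /(_ isT)/=; rewrite mulf_eq0 gt_eqF//= => /eqP.
have z0 : z ord0 = 0.
  apply/eqP/negPn/negP => zn0.
  have ziter k : z (iter k (@ordS _) i0) = 0.
    elim: k => [|k IH]; first by rewrite /z/= /c divfK ?subrr ?gt_eqF.
    by rewrite iterS zS//; apply: contraNneq zn0 => <-; rewrite IH.
  have iterE k : iter k (@ordS _) i0 = ((i0 + k) %% n.+1)%N :> nat.
    elim: k => [|k IH]; first by rewrite addn0 modn_small.
    by rewrite iterS/= IH -[(_ %% _)%N.+1]addn1 modnDml addn1 addnS.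
  have := ziter (n.+1 - i0)%N.
  have -> : iter (n.+1 - i0) (@ordS _) i0 = ord0.
    by apply: val_inj; rewrite /= iterE subnKC ?modnn// ltnW.
  exact/eqP.
(* As [w] vanishes at 0, the value of [z] there is [- c * x ord0]; so [c = 0] and [z] is [w]
   itself. *)
have c0 : c = 0.
  move/eqP: z0; rewrite /z w0 sub0r oppr_eq0 mulf_eq0 => /orP[/eqP//|].
  by rewrite gt_eqF.
by move=> i; have := z_ge0 i; rewrite /z c0 mul0r subr0.
Qed.

(** * Weights of the base and block decomposition of the series *)

Definition scale (R : realType) (p : nat) (b : p.-tuple R) (n : nat) : R :=
  \prod_(k < n) (base_at b k)^-1.

Lemma base_at_gt0 (R : realType) (p : nat) (b : p.-tuple R) (n : nat) :
  (0 < p)%N -> alternate_base b -> 0 < base_at b n.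
Proof.
move=> p0 hb; have lt_np : (n %% p < p)%N by rewrite ltn_mod.
by rewrite /base_at -(tnth_nth 0 b (Ordinal lt_np)) (lt_trans ltr01).
Qed.

Lemma scale_gt0 (R : realType) (p : nat) (b : p.-tuple R) (n : nat) :
  (0 < p)%N -> alternate_base b -> 0 < scale b n.
Proof. by move=> p0 hb; apply: prodr_gt0 => k _; rewrite invr_gt0 base_at_gt0. Qed.

Lemma base_prod_gt1 (R : realType) (p : nat) (b : p.-tuple R) :
  (0 < p)%N -> alternate_base b -> 1 < base_prod b.
Proof.
case: p b => // p b _ hb; rewrite /base_prod big_ord_recl.
apply: (lt_le_trans (hb ord0)); apply: ler_peMr.
  exact/ltW/(lt_trans ltr01)/hb.
by elim/big_ind: _ => // [y z|i _]; [exact: mulr_ege1|exact/ltW/hb].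
Qed.

Lemma scaleS (R : realType) (p : nat) (b : p.-tuple R) (n : nat) :
  scale b n.+1 = scale b n / base_at b n.
Proof. by rewrite /scale big_ord_recr. Qed.

Lemma scale_add (R : realType) (p : nat) (b : p.-tuple R) (i m : nat) :
  scale b (i + m)%N = scale b i / \prod_(k < m) base_at b (i + k).
Proof.
elim: m => [|m IH]; first by rewrite addn0 big_ord0 divr1.
by rewrite addnS scaleS IH big_ord_recr/= invfM mulrA.
Qed.

Lemma scale_addp (R : realType) (p : nat) (b : p.-tuple R) (n : nat) :
  scale b (n + p)%N = (base_prod b)^-1 * scale b n.
Proof.
elim: n => [|n IH].
  rewrite add0n /scale big_ord0 mulr1 -prodfV.
  by apply: eq_bigr => i _; rewrite /base_at modn_small// -tnth_nth.
by rewrite addSn !scaleS IH /base_at modnDr mulrA.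
Qed.

Lemma scale_addMp (R : realType) (p : nat) (b : p.-tuple R) (n m : nat) :
  scale b (n + m * p)%N = (base_prod b)^-1 ^+ m * scale b n.
Proof.
elim: m => [|m IH]; first by rewrite addn0 mul1r.
by rewrite mulSn (addnC p) addnA scale_addp IH exprS mulrA.
Qed.

(** After multiplication by [scale b i] the weights of the i-th series are a shift of the single
    sequence [scale b], so the hypotheses become relations among the same numbers. *)
Lemma value_termE (R : realType) (p : nat) (b : p.-tuple R) (i : nat)
    (u : nat -> int) (n : nat) : (0 < p)%N -> alternate_base b ->
  value_term b i u n = (u n)%:~R * (scale b (i + n)%N.+1 / scale b i).
Proof.
move=> p0 hb; rewrite -addnS scale_add /value_term.
by congr (_ * _); rewrite mulrAC divff ?mul1r// gt_eqF// scale_gt0.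
Qed.

(* Shifting the index by t * p multiplies the terms of rank at least N * p by
   z ^+ t, hence s - S (N + t) = z ^+ t * (s - S N). *)
Lemma value_periodic (R : realType) (p : nat) (b : p.-tuple R) (i : nat)
    (u : nat -> int) (s : R) (N t : nat) : (0 < p)%N -> alternate_base b ->
  (forall n, (N * p <= n)%N -> u (n + t * p)%N = u n) ->
  series (value_term b i u) @ \oo --> s ->
  let S L := series (value_term b i u) (L * p)%N in
  let z := (base_prod b)^-1 in
  (1 - z ^+ t) * s = S (N + t)%N - z ^+ t * S N.
Proof.
move=> p0 hb per us S z.
have vt n : (N * p <= n)%N ->
    value_term b i u (n + t * p)%N = z ^+ t * value_term b i u n.
  move=> Nn; rewrite !value_termE// per// addnA -addSn scale_addMp.
  by rewrite -[in RHS]/(_^-1) -/z -!mulrA mulrCA.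
(* Finite form of the identity, to be passed to the limit in [M]. *)
have SD M : S (M + N + t)%N = S (N + t)%N + z ^+ t * (S (M + N)%N - S N).
  elim: M => [|M IH]; first by rewrite subrr mulr0 addr0.
  have SS L : S L.+1 = S L + \sum_(0 <= j < p) value_term b i u (j + L * p)%N.
    rewrite /S mulSn addnC /series/= (@big_cat_nat _ _ _ (L * p))//= ?leq_addr//.
    by rewrite -{2}[(L * p)%N]add0n big_addn addKn.
  rewrite !addSn !SS IH (_ : \sum_(0 <= j < p) value_term b i u (j + (M + N + t) * p)%N =
    z ^+ t * \sum_(0 <= j < p) value_term b i u (j + (M + N) * p)%N); first by ring.
  rewrite mulr_sumr; apply: eq_bigr => j _; rewrite mulnDl addnA vt//.
  by rewrite mulnDl addnA leq_addl.
have cS k : S (M + k)%N @[M --> \oo] --> s.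
  have cn : ((M + k) * p)%N @[M --> \oo] --> \oo.
    exact: (cvg_comp _ _ (cvg_addnr k) (cvg_mulnr p p0)).
  exact: (cvg_comp _ _ cn us).
have : s = S (N + t)%N + z ^+ t * (s - S N).
  have := cS (N + t)%N.
  rewrite (_ : (fun M => S (M + (N + t))%N) =
    (fun M => S (N + t)%N + z ^+ t * (S (M + N)%N - S N))); last first.
    by apply/funext => M; rewrite addnA SD.
  move=> cS'; apply: (cvg_unique _ cS') => //.
  apply: cvgD; first exact: cvg_cst.
  by apply: cvgM; [exact: cvg_cst|apply: cvgB => //; exact: cvg_cst].
by move=> sE; rewrite mulrBl mul1r {1}sE; ring.
Qed.

(** Writing the rank as [m * p + j] with [j < p], the weight is [z ^+ m] times one depending on [j]
    only, so each residue [j] contributes a polynomial in [z]. *)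
Lemma series_block (R : realType) (p : nat) (b : p.-tuple R) (i : nat)
    (u : nat -> int) (L : nat) : (0 < p)%N -> alternate_base b ->
  scale b i * series (value_term b i u) (L * p)%N =
  \sum_(j < p) scale b (i + j)%N.+1 *
    (map_poly intr (\poly_(m < L) u (m * p + j)%N)).[(base_prod b)^-1].
Proof.
move=> p0 hb; rewrite /series/= big_nat_mul big_mkord mulr_sumr.
transitivity (\sum_(m < L) \sum_(j < p) scale b (i + j)%N.+1 *
    ((u (m * p + j)%N)%:~R * (base_prod b)^-1 ^+ m)); last first.
  rewrite exchange_big/=; apply: eq_bigr => j _; rewrite -mulr_sumr.
  rewrite (@horner_coef_wide _ L).
    by congr (_ * _); apply: eq_bigr => m _; rewrite coef_map_id0//= coef_poly ltn_ord.
  by rewrite (leq_trans (size_poly _ _))// size_poly.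
apply: eq_bigr => m _; rewrite mulSn -{1}[(m * p)%N]add0n big_addn addnK.
rewrite mulr_sumr big_mkord; apply: eq_bigr => j _; rewrite value_termE//.
rewrite mulrCA (addnC (m * p)%N) addnA -addSn scale_addMp.
rewrite [scale b i * _]mulrC divfK ?gt_eqF ?scale_gt0//; ring.
Qed.

(** * Evaluation of integer polynomials and integrality *)

(** Written as a composite of ring morphisms, so that it inherits their structure and commutes with
    determinants. *)
Definition int_eval (R : realType) (z : R) : {poly int} -> R :=
  horner_eval z \o map_poly intr.

HB.instance Definition _ (R : realType) (z : R) :=
  GRing.RMorphism.copy (int_eval z) (horner_eval z \o map_poly intr).

Lemma int_evalX (R : realType) (z : R) : int_eval z 'X = z.
Proof. by rewrite /int_eval/= map_polyX horner_evalE hornerX. Qed.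

Lemma int_evalC (R : realType) (z : R) (c : int) : int_eval z c%:P = c%:~R.
Proof. by rewrite /int_eval/= map_polyC horner_evalE hornerC. Qed.

Lemma int_eval_divring (R : realType) (K : divringClosed R) (z : R) P :
  z \in K -> int_eval z P \in K.
Proof.
move=> Kz; rewrite /int_eval/= horner_evalE horner_coef rpred_sum// => k _.
by rewrite rpredM ?rpredX// coef_map_id0// rpred_int.
Qed.

Lemma int_eval_poly (R : realType) (z : R) n (E : nat -> int) :
  int_eval z (\poly_(m < n) E m) = \sum_(m < n) (E m)%:~R * z ^+ m.
Proof.
rewrite poly_def rmorph_sum/=; apply: eq_bigr => m _.
by rewrite -mul_polyC rmorphM rmorphXn/= int_evalX int_evalC.
Qed.

Lemma unitriangular_system_integral (R : realType) (n : nat) (beta : R)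
    (D : 'I_n -> {poly int}) (M : 'I_n -> 'I_n -> {poly int}) (x : 'I_n -> R) :
  beta != 0 -> (exists i, x i != 0) -> (forall i, (D i)`_0 = 1) ->
  (forall i l : 'I_n, (l <= i)%N -> (M i l)`_0 = 0) ->
  (forall i, int_eval beta^-1 (D i) * x i =
     \sum_l int_eval beta^-1 (M i l) * x l) ->
  algebraic_integer beta.
Proof.
move=> beta0 [i0 xi0] D0 M0 xM.
(* Equation [i] is stored in column [i]: the row vector [x] is then in the left kernel of the
   evaluated matrix, and the constant coefficients form a lower unitriangular matrix. *)
pose W : 'M[{poly int}]_n := \matrix_(l, i) ((D i) *+ (l == i) - M i l).
apply: (@reciprocal_root_integral _ _ (\det W)) => //.
  rewrite -horner_coef0 -horner_evalE -det_map_mx det_trig; last first.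
    apply/is_trig_mxP => l i li; rewrite !mxE /= horner_evalE horner_coef0.
    have -> : (l == i) = false by apply/negP => /eqP lE; rewrite lE ltnn in li.
    by rewrite mulr0n sub0r coefN M0 ?oppr0// ltnW.
  rewrite big1// => i _.
  by rewrite !mxE /= horner_evalE horner_coef0 eqxx mulr1n coefB D0 M0 ?subr0.
rewrite -[LHS]/(int_eval beta^-1 (\det W)) -det_map_mx; apply/eqP/det0P.
exists (\row_i x i).
  by apply: contraNneq xi0 => /rowP/(_ i0); rewrite !mxE => ->.
apply/rowP => i; rewrite !mxE.
under eq_bigr do rewrite !mxE rmorphB rmorphMn/= mulrBr mulrnAr.
rewrite sumrB (bigD1 i)//= eqxx mulr1n big1 ?addr0; last first.
  by move=> l /negbTE ->.
by rewrite mulrC xM; apply/eqP; rewrite subr_eq0; apply/eqP/eq_bigr => l _; rewrite mulrC.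
Qed.

(** * Coefficients of the linear system *)

(** For digits of period [t * p] from rank [N * p] on, this is [1 - 'X^t] times the generating
    series of the digits of rank congruent to [j] modulo [p]. *)
Definition block_poly (u : nat -> int) (p j N t : nat) : {poly int} :=
  \poly_(m < N + t) u (m * p + j)%N - 'X^t * \poly_(m < N) u (m * p + j)%N.

(** The first [N] terms combine with the subtracted sum into the left side; the [t] terms left over
    are non-negative. *)
Lemma block_poly_ge (R : realType) (z : R) (u : nat -> int) (p j N t : nat) :
  0 <= z -> (forall n, 0 <= u n) ->
  (1 - z ^+ t) * \sum_(m < N) (u (m * p + j)%N)%:~R * z ^+ m <=
    int_eval z (block_poly u p j N t).
Proof.
move=> z0 u0; rewrite rmorphB rmorphM rmorphXn/= int_evalX !int_eval_poly.
rewrite mulrBl mul1r lerD2r big_split_ord/= lerDl sumr_ge0// => m _.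
by rewrite mulr_ge0 ?exprn_ge0// ler0z.
Qed.

Lemma block_poly_ge0 (R : realType) (z : R) (u : nat -> int) (p j N t : nat) :
  0 <= z -> z <= 1 -> (forall n, 0 <= u n) ->
  0 <= int_eval z (block_poly u p j N t).
Proof.
move=> z0 z1 u0; apply: le_trans (block_poly_ge _ _ _ _ z0 u0).
rewrite mulr_ge0 ?subr_ge0 ?exprn_ile1// sumr_ge0// => m _.
by rewrite mulr_ge0 ?exprn_ge0// ler0z.
Qed.

Lemma block_poly_gt0 (R : realType) (z : R) (u : nat -> int)
    (p j N t m : nat) :
  0 < z -> z < 1 -> (0 < t)%N -> (forall n, 0 <= u n) -> (m < N)%N ->
  1 <= u (m * p + j)%N -> 0 < int_eval z (block_poly u p j N t).
Proof.
move=> z0 z1 t0 u0 mN um; apply: lt_le_trans (block_poly_ge _ _ _ _ (ltW z0) u0).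
rewrite mulr_gt0 ?subr_gt0 ?exprn_ilt1 -?lt0n ?(ltW z0)//.
rewrite (bigD1 (Ordinal mN))//= ltr_wpDr//.
  by rewrite sumr_ge0// => k _; rewrite mulr_ge0 ?exprn_ge0 ?(ltW z0)// ler0z.
by rewrite mulr_gt0 ?exprn_gt0// ltr0z (lt_le_trans ltr01).
Qed.

(** The [M_il] of the overview: the weight of index [i + j + 1] reduces to that of its remainder
    modulo [p], the quotient becoming a power of [z]. *)
Definition row_poly (u : nat -> int) (q : int) (p i N t l : nat) : {poly int} :=
  q%:P * \sum_(j < p | ((i + j).+1 %% p == l)%N)
    block_poly u p j N t * 'X^((i + j).+1 %/ p)%N.

Lemma row_poly_coef0 (u : nat -> int) (q : int) (p i N t l : nat) :
  (l <= i)%N -> (row_poly u q p i N t l)`_0 = 0.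
Proof.
move=> li; rewrite coefCM coef_sum big1 ?mulr0// => j /eqP jl.
rewrite coefMXn; case: posnP => // k0.
(* A zero quotient would force [l = i + j + 1 > i]. *)
have := divn_eq (i + j)%N.+1 p; rewrite k0 jl mul0n add0n => lE.
by move: li; rewrite -lE ltnNge leq_addr.
Qed.

Lemma row_relation (R : realType) (p : nat) (b : p.-tuple R) (i : nat)
    (u : nat -> int) (q : int) (N t : nat) :
  (0 < p)%N -> alternate_base b -> q != 0 ->
  (forall n, (N * p <= n)%N -> u (n + t * p)%N = u n) ->
  series (value_term b i u) @ \oo --> (1 / q%:~R : R) ->
  let z := (base_prod b)^-1 in
  int_eval z (1 - 'X^t) * scale b i =
  \sum_(l < p) int_eval z (row_poly u q p i N t l) * scale b l.
Proof.
move=> p0 hb q0 per us z.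
have qR : q%:~R != 0 :> R by rewrite intr_eq0.
rewrite rmorphB rmorph1 rmorphXn/= int_evalX.
(* Inserting [q * (1 / q)] makes the value of the series appear while the coefficients stay
   integral. *)
have -> : (1 - z ^+ t) * scale b i =
    q%:~R * (scale b i * ((1 - z ^+ t) * (1 / q%:~R))) by field.
rewrite (value_periodic p0 hb per us) -/z.
transitivity (\sum_(j < p) q%:~R *
    (scale b (i + j)%N.+1 * int_eval z (block_poly u p j N t))).
  rewrite -mulr_sumr; congr (_ * _).
  rewrite mulrBr mulrCA !series_block// -/z mulr_sumr -sumrB.
  apply: eq_bigr => j _.
  by rewrite rmorphB rmorphM rmorphXn/= int_evalX mulrBr [in RHS]mulrCA.
rewrite (partition_big (fun j : 'I_p => Ordinal (ltn_pmod (i + j)%N.+1 p0)) xpredT)//=.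
apply: eq_bigr => l _; rewrite rmorphM rmorph_sum/= int_evalC mulr_sumr mulr_suml.
apply: eq_big => [j|j /eqP jl]; first by rewrite -val_eqE.
rewrite {1}(divn_eq (i + j)%N.+1 p) addnC scale_addMp -/z -jl/=.
by rewrite rmorphM rmorphXn/= int_evalX; ring.
Qed.

Lemma row_poly_ge0 (R : realType) (z : R) (u : nat -> int) (q : int)
    (p i N t l : nat) :
  0 <= z -> z <= 1 -> 0 <= q -> (forall n, 0 <= u n) ->
  0 <= int_eval z (row_poly u q p i N t l).
Proof.
move=> z0 z1 q0 u0; rewrite rmorphM rmorph_sum/= int_evalC.
rewrite mulr_ge0 ?ler0z// sumr_ge0// => j _.
by rewrite rmorphM rmorphXn/= int_evalX mulr_ge0 ?exprn_ge0 ?block_poly_ge0.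
Qed.

(** The summand [j = 0] lands on [i + 1] modulo [p] and collects the digits at multiples of [p], one
    of which is positive. *)
Lemma row_poly_gt0 (R : realType) (z : R) (u : nat -> int) (q : int)
    (p i N t m : nat) :
  (0 < p)%N -> 0 < z -> z < 1 -> 0 < q -> (0 < t)%N ->
  (forall n, 0 <= u n) -> (m < N)%N -> 1 <= u (m * p)%N ->
  0 < int_eval z (row_poly u q p i N t (i.+1 %% p)%N).
Proof.
move=> p0 z0 z1 q0 t0 u0 mN um; rewrite rmorphM rmorph_sum/= int_evalC.
rewrite mulr_gt0 ?ltr0z// (bigD1 (Ordinal p0))/= ?addn0// ltr_wpDr//.
  rewrite sumr_ge0// => j _; rewrite rmorphM rmorphXn/= int_evalX.
  by rewrite mulr_ge0 ?exprn_ge0 ?block_poly_ge0 ?(ltW z0) ?(ltW z1).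
rewrite rmorphM rmorphXn/= int_evalX mulr_gt0 ?exprn_gt0//.
by rewrite (block_poly_gt0 z0 z1 t0 u0 mN)// addn0.
Qed.

(** * From the linear system to the theorem *)

Lemma ultimately_periodicM (T : Type) (u : nat -> T) (p : nat) :
  (0 < p)%N -> ultimately_periodic u ->
  exists N t : nat, (0 < t)%N /\
    forall n, (N * p <= n)%N -> u (n + t * p)%N = u n.
Proof.
move=> p0 [N [t [t0 ut]]]; exists N, t; split=> // n Nn.
have {Nn} : (N <= n)%N by rewrite (leq_trans _ Nn)// leq_pmulr.
rewrite mulnC; elim: p {p0} => [|p IH] Nn; first by rewrite addn0.
by rewrite mulSn addnCA addnC ut ?IH// (leq_trans Nn)// leq_addr.
Qed.

(* The minimum principle, applied to w and to -w, shows that the system in which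
   the equation of index 0 is replaced by x_0 = 1 is invertible. *)
Lemma positive_system_divring (R : realFieldType) (K : divringClosed R) n
    (d x : 'I_n.+1 -> R) (M : 'I_n.+1 -> 'I_n.+1 -> R) :
  (forall i, d i \in K) -> (forall i l, M i l \in K) ->
  (forall i l, 0 <= M i l) -> (forall i, 0 < M i (ordS i)) ->
  (forall i, 0 < x i) -> (forall i, d i * x i = \sum_l M i l * x l) ->
  x ord0 = 1 -> forall i, x i \in K.
Proof.
move=> Kd KM M0 MS x0 Mx x1 i.
pose B : 'M[R]_n.+1 := \matrix_(l, i)
  if i == ord0 then (l == ord0)%:R else d i *+ (l == i) - M i l.
have BE (y : 'I_n.+1 -> R) i' : (\row_l y l *m B) 0 i' =
    if i' == ord0 then y ord0 else d i' * y i' - \sum_l M i' l * y l.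
  rewrite mxE; case: ifPn => i'0.
    rewrite (bigD1 ord0)//= big1 ?addr0 => [|l /negbTE l0].
      by rewrite !mxE i'0 eqxx mulr1.
    by rewrite !mxE i'0 l0 mulr0.
  under eq_bigr do rewrite !mxE (negbTE i'0) mulrBr mulrnAr.
  rewrite sumrB (bigD1 i')//= eqxx mulr1n big1 ?addr0; last first.
    by move=> l /negbTE ->.
  by rewrite mulrC; congr (_ - _); apply: eq_bigr => l _; rewrite mulrC.
have -> : x i = (\row_l x l) 0 i by rewrite mxE.
apply: (@mulmx_invmx_divring _ K _ B (\row_l x l) (\row_l (l == ord0)%:R)).
- rewrite unitmxE unitfE; apply/negP => /det0P[v /negP v0 vB].
  apply: v0; apply/eqP/rowP => l; rewrite mxE.
  have vE : v = \row_l v 0 l by apply/rowP => l'; rewrite mxE.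
  have vM i' := esym (BE (v 0) i').
  have w0 : v 0 ord0 = 0 by have := vM ord0; rewrite eqxx -vE vB mxE.
  have Mw i' : i' != ord0 -> d i' * v 0 i' = \sum_l M i' l * v 0 l.
    move=> /negbTE i'0; have := vM i'; rewrite i'0 -vE vB mxE => /eqP.
    by rewrite subr_eq0 => /eqP.
  apply/eqP; rewrite eq_le (minimum_principle M0 MS x0 Mx w0 Mw) andbT -oppr_ge0.
  apply: (minimum_principle M0 MS x0 Mx (w := fun l => - v 0 l)).
    by rewrite w0 oppr0.
  move=> i' i'0; rewrite mulrN Mw// -sumrN.
  by apply: eq_bigr => l' _; rewrite mulrN.
- apply/rowP => i'; rewrite BE mxE; case: eqVneq => [_|i'0]; first by rewrite x1.
  by rewrite Mx subrr.
- move=> l i'; rewrite mxE; case: ifP => _; first by rewrite rpredMn// rpred1.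
  by rewrite rpredB// rpredMn.
- by move=> l; rewrite mxE rpredMn// rpred1.
Qed.

Theorem theorem6 (R : realType) (p : nat) (hp : (1 <= p)%N)
    (b : p.-tuple R) (hb : alternate_base b)
    (q : 'I_p -> int) (a : 'I_p -> nat -> int)
    (hq : forall i, q i != 0)
    (ha : forall i, ultimately_periodic (a i))
    (hs : forall i : 'I_p,
      series (value_term b i (a i)) @ \oo --> (1 / (q i)%:~R : R)) :
  algebraic_integer (base_prod b) /\
  ((forall i n, 0 <= a i n) ->
   (forall i : 'I_p, exists m : nat, 1 <= a i (m * p)%N) ->
   forall i : 'I_p, tnth b i \in rational_adjoin (base_prod b)).
Proof.
case: p hp b hb q a hq ha hs => // p hp b hb q a hq ha hs.
have beta1 := base_prod_gt1 hp hb; have beta0 := lt_trans ltr01 beta1.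
have /choice[N /choice[t Nt]] := fun i => ultimately_periodicM hp (ha i).
have t0 i := (Nt i).1; have per i := (Nt i).2.
split.
  apply: (@unitriangular_system_integral _ _ _ (fun i => 1 - 'X^(t i))
    (fun i l => row_poly (a i) (q i) p.+1 i (N i) (t i) l) (fun i => scale b i)).
  - by rewrite gt_eqF.
  - by exists (Ordinal hp); rewrite gt_eqF// scale_gt0.
  - by move=> i; rewrite coefB coef1 coefXn/= eq_sym gtn_eqF ?subr0.
  - by move=> i l li; exact: row_poly_coef0.
  - by move=> i; exact: row_relation hp hb (hq i) (per i) (hs i).
move=> a0 /choice[m am] i.
have z0 : 0 < (base_prod b)^-1 by rewrite invr_gt0.
have z1 : (base_prod b)^-1 < 1 by rewrite invf_lt1.
(* The limit [1 / q j] of non-negative partial sums is non-negative. *)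
have q0 j : 0 < q j.
  rewrite lt_def hq -(ler0z R) -invr_ge0 -div1r -(cvg_lim _ (hs j))//.
  apply: limr_ge; first exact: cvgP (hs j).
  apply: nearW => n; rewrite sumr_ge0// => k _; rewrite value_termE//.
  by rewrite mulr_ge0 ?ler0z ?a0// divr_ge0 ?ltW ?scale_gt0.
(* The preperiod is lengthened so that the positive digit of rank [m j * p] lies before its end. *)
pose N' j := maxn (N j) (m j).+1.
have per' j n : (N' j * p.+1 <= n)%N -> a j (n + t j * p.+1)%N = a j n.
  move=> N'n; apply: per; rewrite (leq_trans _ N'n)// leq_mul2r leq_maxl.
  by rewrite orbT.
rewrite inE => K [Kdiv Kb].
(* The arbitrary subfield [K] containing [beta] is packaged as a structure to which the closure
   lemmas apply. *)
have [KD KDE] : exists KD : divringClosed R, forall y, (y \in KD) = (y \in K).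
  pose Kpred : {pred R} := fun y => y \in K.
  have Kpred_div : divring_closed Kpred by [].
  pose KI := GRing.isDivringClosed.Build R Kpred Kpred_div.
  by exists (HB.pack_for (divringClosed R) Kpred KI).
have Kz : (base_prod b)^-1 \in KD by rewrite rpredV KDE; apply/mem_set/Kb.
have Kscale : forall j : 'I_p.+1, scale b j \in KD.
  apply: (@positive_system_divring _ KD p
    (fun j => int_eval (base_prod b)^-1 (1 - 'X^(t j))) (fun j => scale b j)
    (fun j l => int_eval (base_prod b)^-1
      (row_poly (a j) (q j) p.+1 j (N' j) (t j) l))) => //.
  - by move=> j; exact: int_eval_divring.
  - by move=> j l; exact: int_eval_divring.
  - by move=> j l; apply: row_poly_ge0 (a0 j); exact/ltW.
  - move=> j; apply: (row_poly_gt0 _ _ z0 z1 (q0 j) (t0 j) (a0 j) _ (am j)) => //.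
    by rewrite leq_maxr.
  - by move=> j; exact: scale_gt0.
  - by move=> j; exact: row_relation hp hb (hq j) (per' j) (hs j).
  - by rewrite /scale big_ord0.
(* The quotient below involves index [i + 1], which can equal the period and so fall outside the
   system. *)
have Kscale' n : scale b n \in KD.
  rewrite (divn_eq n p.+1) addnC scale_addMp.
  by rewrite rpredM ?rpredX// (Kscale (Ordinal (ltn_pmod n hp))).
have -> : tnth b i = scale b i / scale b i.+1.
  rewrite scaleS invfM mulVKf ?invrK ?gt_eqF ?scale_gt0//.
  by rewrite /base_at modn_small// -tnth_nth.
by have := rpred_div (Kscale' i) (Kscale' i.+1); rewrite KDE => /set_mem.
Qed.
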